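(* Let $\mathcal{X}\subset\mathbb{R}^n$, $\mathcal{Y}\subset\mathbb{R}^m$ be nonempty convex compact sets, neither equal to $\{\boldsymbol{0}\}$, and let $F:\mathcal{X}\times\mathcal{Y}\to\mathbb{R}$ be subdifferentiable, convex-concave, and such that $(\boldsymbol{x},\boldsymbol{y})\mapsto F(\boldsymbol{x},\boldsymbol{y})$ is linear in $\boldsymbol{x}$. Let $\kappa=\max_{\boldsymbol{x}\in\mathcal{X}}\|\boldsymbol{x}\|_2$, $\mathcal{C}=\mathrm{cone}(\{\kappa\}\times\mathcal{X})$, and let $(\omega_t)_{t\ge1}$ be positive weights. 1. Suppose that $(\boldsymbol{x}_t)_{t\ge1},(\boldsymbol{y}_t)_{t\ge1}$ are generated by the repeated game framework with alternation in which both players use CBA$^+$ with weights $(\omega_t)_{t\ge1}$ on the payoffs, and let $(\boldsymbol{u}_t^x)_{t\ge0}$ be the aggregate payoffs of the first player. Then, for $t\ge1$, $$F(\boldsymbol{x}_{t+1},\boldsymbol{y}_t)-F(\boldsymbol{x}_t,\boldsymbol{y}_t)\le-\frac{\kappa}{\omega_t\cdot\|\boldsymbol{u}_t^x\|_\infty}\,\|\boldsymbol{u}_t^x-\boldsymbol{u}_{t-1}^x\|_2^2.$$ 2. Suppose that $(\boldsymbol{x}_t)_{t\ge1},(\boldsymbol{y}_t)_{t\ge1}$ are generated by the repeated game framework with alternation in which both players use CBA with weights $(\omega_t)_{t\ge1}$ on the payoffs, and let $(\boldsymbol{u}_t^x)_{t\ge0}$ be the aggregate payoffs of the first player. Then,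 for $t\ge1$, $$F(\boldsymbol{x}_{t+1},\boldsymbol{y}_t)-F(\boldsymbol{x}_t,\boldsymbol{y}_t)\le-\frac{\kappa}{\omega_t\cdot\|\pi_{\mathcal{C}}(\boldsymbol{u}_t^x)\|_\infty}\,\|\pi_{\mathcal{C}}(\boldsymbol{u}_t^x)-\pi_{\mathcal{C}}(\boldsymbol{u}_{t-1}^x)\|_2^2.$$ In both bounds the convention $0/0=0$ is used on the right-hand side.
   Context: Linear in $\boldsymbol{x}$ means that for each $\boldsymbol{y}\in\mathcal{Y}$ there is $\boldsymbol{h}(\boldsymbol{y})\in\mathbb{R}^n$ with $F(\boldsymbol{x},\boldsymbol{y})=\langle\boldsymbol{h}(\boldsymbol{y}),\boldsymbol{x}\rangle$ for all $\boldsymbol{x}\in\mathcal{X}$; the (sub)gradient in $\boldsymbol{x}$ is then $\partial_{\boldsymbol{x}}F(\boldsymbol{x},\boldsymbol{y})=\boldsymbol{h}(\boldsymbol{y})$. $\partial_{\boldsymbol{y}}F$ denotes supergradients of the concave function $F(\boldsymbol{x},\cdot)$. For a nonempty convex compact $\mathcal{Z}\subset\mathbb{R}^k$ let $\kappa_{\mathcal{Z}}=\max_{\boldsymbol{z}\in\mathcal{Z}}\|\boldsymbol{z}\|_2>0$, $\mathcal{C}_{\mathcal{Z}}=\mathrm{cone}(\{\kappa_{\mathcal{Z}}\}\times\mathcal{Z})=\{\alpha(\kappa_{\mathcal{Z}},\boldsymbol{z}):\alpha\ge0,\boldsymbol{z}\in\mathcal{Z}\}\subset\mathbb{R}^{k+1}$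 (so $\mathcal{C}=\mathcal{C}_{\mathcal{X}}$, $\kappa=\kappa_{\mathcal{X}}$), and let $\pi_{\mathcal{C}_{\mathcal{Z}}}$ be the Euclidean projection. For $\boldsymbol{w}=(\tilde w,\hat{\boldsymbol{w}})\in\mathcal{C}_{\mathcal{Z}}$ let $D_{\mathcal{Z}}(\boldsymbol{w})=(\kappa_{\mathcal{Z}}/\tilde w)\hat{\boldsymbol{w}}$ if $\tilde w\ne0$ and $D_{\mathcal{Z}}(\boldsymbol{w})=\boldsymbol{z}_0$, a fixed default point of $\mathcal{Z}$, if $\tilde w=0$. For a loss $\boldsymbol{h}\in\mathbb{R}^k$, decision $\boldsymbol{z}$ and weight $\omega$, set $\boldsymbol{v}=(\langle\boldsymbol{h},\boldsymbol{z}\rangle/\kappa_{\mathcal{Z}},-\boldsymbol{h})$ and define - for CBA$^+$: $\mathrm{CHOOSE}(\boldsymbol{u})=D_{\mathcal{Z}}(\boldsymbol{u})$ and $\mathrm{UPDATE}(\boldsymbol{u},\boldsymbol{z},\boldsymbol{h},\omega)=\pi_{\mathcal{C}_{\mathcal{Z}}}(\boldsymbol{u}+\omega\boldsymbol{v})$; - for CBA: $\mathrm{CHOOSE}(\boldsymbol{u})=D_{\mathcal{Z}}(\pi_{\mathcal{C}_{\mathcal{Z}}}(\boldsymbol{u}))$ and $\mathrm{UPDATE}(\boldsymbol{u},\boldsymbol{z},\boldsymbol{h},\omega)=\boldsymbol{u}+\omega\boldsymbol{v}$. Repeated game framework with alternation: start with $\boldsymbol{u}_0^x=\boldsymbol{0}$,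 $\boldsymbol{u}_0^y=\boldsymbol{0}$, $\boldsymbol{y}_0$ the default point of $\mathcal{Y}$. For $t\ge1$: (i) $\boldsymbol{x}_t=\mathrm{CHOOSE}(\boldsymbol{u}_{t-1}^x)$ (with $\mathcal{Z}=\mathcal{X}$); (ii) with $\boldsymbol{g}_{t-1}\in\partial_{\boldsymbol{y}}F(\boldsymbol{x}_t,\boldsymbol{y}_{t-1})$, the second (maximizing) player sets $\boldsymbol{u}_t^y=\mathrm{UPDATE}(\boldsymbol{u}_{t-1}^y,\boldsymbol{y}_{t-1},-\boldsymbol{g}_{t-1},\omega_t)$ (with $\mathcal{Z}=\mathcal{Y}$); (iii) $\boldsymbol{y}_t=\mathrm{CHOOSE}(\boldsymbol{u}_t^y)$; (iv) with $\boldsymbol{f}_t=\partial_{\boldsymbol{x}}F(\boldsymbol{x}_t,\boldsymbol{y}_t)=\boldsymbol{h}(\boldsymbol{y}_t)$, the first player sets $\boldsymbol{u}_t^x=\mathrm{UPDATE}(\boldsymbol{u}_{t-1}^x,\boldsymbol{x}_t,\boldsymbol{f}_t,\omega_t)$. *)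

(* Defs.v *)
From mathcomp Require Import all_boot all_order all_algebra.
From mathcomp Require Import all_classical all_reals all_analysis.

Set Implicit Arguments.
Unset Strict Implicit.
Unset Printing Implicit Defensive.

Import Order.TTheory GRing.Theory Num.Theory.
Import numFieldNormedType.Exports.

Local Open Scope classical_set_scope.
Local Open Scope ring_scope.

(* Points of R^k are row vectors. The library norm `|u| on 'rV[R]_k is the
   max norm, i.e. ||u||_oo; the Euclidean norm is [norm2]. *)

Definition dot (R : realType) k (u v : 'rV[R]_k) : R :=
  \sum_(i < k) u 0 i * v 0 i.

Definition norm2 (R : realType) k (u : 'rV[R]_k) : R := Num.sqrt (dot u u).

(* max_(z in Z) ||z||_2: the supremum is attained when Z is nonempty and
   compact. *)
Definition max_norm2 (R : realType) k (Z : set 'rV[R]_k) : R :=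
  sup [set norm2 z | z in Z].

Definition cone (R : realType) k (S : set 'rV[R]_k) : set 'rV[R]_k :=
  [set w | exists a s, [/\ 0 <= a, S s & w = a *: s]].

(* The vector (a, z) of R^(k+1); its components are recovered by [fstc] and
   [sndc]. *)
Definition pairv (R : realType) k (a : R) (z : 'rV[R]_k) : 'rV[R]_(1 + k) :=
  row_mx a%:M z.

Definition fstc (R : realType) k (w : 'rV[R]_(1 + k)) : R := lsubmx w 0 0.

Definition sndc (R : realType) k (w : 'rV[R]_(1 + k)) : 'rV[R]_k := rsubmx w.

Definition coneof (R : realType) k (Z : set 'rV[R]_k) : set 'rV[R]_(1 + k) :=
  cone [set pairv (max_norm2 Z) z | z in Z].

(* A point of C nearest to u: it exists and is unique when C is nonempty,
   closed and convex. *)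
Definition eproj (R : realType) k (C : set 'rV[R]_k) (u : 'rV[R]_k) : 'rV[R]_k :=
  get [set w | C w /\ forall w', C w' -> norm2 (u - w) <= norm2 (u - w')].

Definition decision_of (R : realType) k (Z : set 'rV[R]_k) (z0 : 'rV[R]_k)
    (w : 'rV[R]_(1 + k)) : 'rV[R]_k :=
  if fstc w != 0 then (max_norm2 Z / fstc w) *: sndc w else z0.

Definition payoff (R : realType) k (Z : set 'rV[R]_k) (z h : 'rV[R]_k) :
    'rV[R]_(1 + k) :=
  pairv (dot h z / max_norm2 Z) (- h).

Record algorithm (R : realType) (k : nat) := Algorithm {
  alg_choose : 'rV[R]_(1 + k) -> 'rV[R]_k ;
  (* aggregate payoff, decision, loss, weight *)
  alg_update : 'rV[R]_(1 + k) -> 'rV[R]_k -> 'rV[R]_k -> R -> 'rV[R]_(1 + k)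
}.

Definition CBAplus (R : realType) k (Z : set 'rV[R]_k) (z0 : 'rV[R]_k) :
    algorithm R k :=
  {| alg_choose := fun u => decision_of Z z0 u ;
     alg_update := fun u z h w => eproj (coneof Z) (u + w *: payoff Z z h) |}.

Definition CBA (R : realType) k (Z : set 'rV[R]_k) (z0 : 'rV[R]_k) :
    algorithm R k :=
  {| alg_choose := fun u => decision_of Z z0 (eproj (coneof Z) u) ;
     alg_update := fun u z h w => u + w *: payoff Z z h |}.

(* Sub- and supergradients are relative to the domain D, that is, those of f
   extended by +oo, resp. -oo, outside D. *)
Definition subgradient (R : realType) k (D : set 'rV[R]_k) (f : 'rV[R]_k -> R)
    (x g : 'rV[R]_k) : Prop :=
  forall x', D x' -> f x + dot g (x' - x) <= f x'.

Definition supergradient (R : realType) k (D : set 'rV[R]_k)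
    (f : 'rV[R]_k -> R) (x g : 'rV[R]_k) : Prop :=
  forall x', D x' -> f x' <= f x + dot g (x' - x).

(* A function on X x Y is given as a total function of which only the values
   on X x Y matter. *)
Definition subdifferentiable (R : realType) n m (X : set 'rV[R]_n)
    (Y : set 'rV[R]_m) (F : 'rV[R]_n -> 'rV[R]_m -> R) : Prop :=
  forall x y, X x -> Y y ->
    (exists f, subgradient X (fun x' => F x' y) x f) /\
    (exists g, supergradient Y (F x) y g).

Definition convex_concave (R : realType) n m (X : set 'rV[R]_n)
    (Y : set 'rV[R]_m) (F : 'rV[R]_n -> 'rV[R]_m -> R) : Prop :=
  (forall y, Y y -> convex_function X (fun x => F x y)) /\
  (forall x, X x -> convex_function Y (fun y => - F x y)).

Definition linear_in_fst (R : realType) n m (X : set 'rV[R]_n)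
    (Y : set 'rV[R]_m) (F : 'rV[R]_n -> 'rV[R]_m -> R)
    (h : 'rV[R]_m -> 'rV[R]_n) : Prop :=
  forall x y, X x -> Y y -> F x y = dot (h y) x.

(* Round t.+1 of the game appears under the index t; [x 0] and [omega 0] are
   unused, and the gradient of the first player is [h (y t.+1)]. *)
Definition alternating_play (R : realType) n m (Y : set 'rV[R]_m)
    (F : 'rV[R]_n -> 'rV[R]_m -> R) (h : 'rV[R]_m -> 'rV[R]_n)
    (A : algorithm R n) (B : algorithm R m) (y0 : 'rV[R]_m) (omega : nat -> R)
    (ux : nat -> 'rV[R]_(1 + n)) (uy : nat -> 'rV[R]_(1 + m))
    (x : nat -> 'rV[R]_n) (y g : nat -> 'rV[R]_m) : Prop :=
  [/\ ux 0%N = 0, uy 0%N = 0, y 0%N = y0 &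
    forall t : nat,
      [/\ x t.+1 = alg_choose A (ux t),
          supergradient Y (F (x t.+1)) (y t) (g t),
          uy t.+1 = alg_update B (uy t) (y t) (- g t) (omega t.+1),
          y t.+1 = alg_choose B (uy t.+1) &
          ux t.+1 = alg_update A (ux t) (x t.+1) (h (y t.+1)) (omega t.+1)]].

(* Main.v *)
(* Let w' and w be the projections on the cone C of the first player's
   aggregate payoffs before and after an update by omega v. Both for CBA+ (the
   obtuse-angle property of projections) and for CBA (their firm
   nonexpansiveness), |w - w'|^2 <= omega <v, w - w'>. By the choice of v,
   <v, w'> = 0 and <v, w> is fst w / kappa times <f, x_t - x_(t+1)>, while
   |w|_oo = fst w on C. If w = 0 then w' = 0 and both decisions are the default
   point, so the convention 0 / 0 = 0 is harmless. *)
Require Import Defs.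
From mathcomp Require Import all_boot all_order all_algebra.
From mathcomp Require Import all_classical all_reals all_analysis.
From mathcomp Require Import ring lra.

Set Implicit Arguments.
Unset Strict Implicit.
Unset Printing Implicit Defensive.

Import Order.TTheory GRing.Theory Num.Theory.
Import numFieldNormedType.Exports.

Local Open Scope classical_set_scope.
Local Open Scope ring_scope.

(** * Euclidean inner product and norm *)

Section Dot.
Variables (R : realType) (k : nat).
Implicit Types (u v w : 'rV[R]_k) (a : R).

Lemma dotC u v : dot u v = dot v u.
Proof. by apply: eq_bigr => i _; rewrite mulrC. Qed.

Lemma dotDl u v w : dot (u + v) w = dot u w + dot v w.
Proof. by rewrite -big_split; apply: eq_bigr => i _; rewrite mxE mulrDl. Qed.

Lemma dotZl a u w : dot (a *: u) w = a * dot u w.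
Proof. by rewrite mulr_sumr; apply: eq_bigr => i _; rewrite mxE mulrA. Qed.

Lemma dotNl u w : dot (- u) w = - dot u w.
Proof. by rewrite -scaleN1r dotZl mulN1r. Qed.

Lemma dotDr u v w : dot w (u + v) = dot w u + dot w v.
Proof. by rewrite dotC dotDl !(dotC w). Qed.

Lemma dotZr a u w : dot w (a *: u) = a * dot w u.
Proof. by rewrite dotC dotZl (dotC w). Qed.

Lemma dotNr u w : dot w (- u) = - dot w u.
Proof. by rewrite dotC dotNl (dotC w). Qed.

Definition dotE := (dotDl, dotDr, dotNl, dotNr, dotZl, dotZr).

Lemma dot0r u : dot u 0 = 0.
Proof. by rewrite -(scale0r 0) dotZr mul0r. Qed.

Lemma dot_ge0 u : 0 <= dot u u.
Proof. by apply: sumr_ge0 => i _; rewrite -expr2 sqr_ge0. Qed.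

Lemma sqr_coord_le_dot u i : u 0 i ^+ 2 <= dot u u.
Proof.
rewrite /dot (bigD1 i)//= -expr2 lerDl.
by apply: sumr_ge0 => j _; rewrite -expr2 sqr_ge0.
Qed.

Lemma dot_le0 u : dot u u <= 0 -> u = 0.
Proof.
move=> u0; apply/rowP => i; rewrite mxE; apply/eqP; rewrite -sqrf_eq0.
by rewrite eq_le sqr_ge0 (le_trans (sqr_coord_le_dot u i)).
Qed.

Lemma norm2_sqr u : norm2 u ^+ 2 = dot u u.
Proof. by rewrite sqr_sqrtr ?dot_ge0. Qed.

Lemma norm2_ge0 u : 0 <= norm2 u.
Proof. exact: sqrtr_ge0. Qed.

Lemma ler_norm2 u v : (norm2 u <= norm2 v) = (dot u u <= dot v v).
Proof. exact/ler_sqrt/dot_ge0. Qed.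

Lemma coord_le_norm2 u i : `|u 0 i| <= norm2 u.
Proof. by rewrite -sqrtr_sqr ler_sqrt ?dot_ge0 ?sqr_coord_le_dot. Qed.

Lemma continuous_dot (T : topologicalType) (f g : T -> 'rV[R]_k) :
  (forall i, continuous (fun x => f x 0 i)) ->
  (forall i, continuous (fun x => g x 0 i)) ->
  continuous (fun x => dot (f x) (g x)).
Proof.
move=> cf cg; apply: continuous_big => [|i _]; first exact: add_continuous.
by move=> x; apply: cvgM; [exact: cf|exact: cg].
Qed.

End Dot.

(** * Euclidean projections onto convex sets *)

Section Projection.
Variables (R : realType) (k : nat).
Implicit Types (C : set 'rV[R]_k) (u v w : 'rV[R]_k).

(** Under this condition the choice made by [get] in [eproj] is a genuine nearest point. *)
Definition has_nearest C := forall u,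
  exists w, C w /\ forall w', C w' -> norm2 (u - w) <= norm2 (u - w').

Definition segment_closed C := forall w w' (s : R),
  C w -> C w' -> 0 <= s -> s <= 1 -> C (w + s *: (w' - w)).

Lemma eproj_in C u : has_nearest C -> C (eproj C u).
Proof. by move=> /(_ u)/getPex[]. Qed.

(** Moving from the projection towards [w] cannot shorten the distance to [u], whereas a positive
    inner product would let a small enough move shorten it. *)
Lemma eproj_obtuse C u w : has_nearest C -> segment_closed C -> C w ->
  dot (u - eproj C u) (w - eproj C u) <= 0.
Proof.
move=> nC cC Cw; have /getPex[] := nC u.
rewrite -/(eproj C u); set p := eproj C u => Cp pmin.
have {}pmin s : 0 <= s -> s <= 1 ->
    norm2 (u - p) <= norm2 (u - p - s *: (w - p)).
  by move=> s0 s1; rewrite -addrA -opprD; apply: pmin; exact: cC.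
move: (u - p) (w - p) pmin => e d pmin; have [//|ed0] := leP (dot e d) 0.
have dd0 : 0 <= dot d d by exact: dot_ge0.
have quad s : 0 <= s -> s <= 1 -> 2 * s * dot e d <= s ^+ 2 * dot d d.
  move=> s0 s1; have := pmin _ s0 s1.
  by rewrite ler_norm2 !dotE (dotC d e); lra.
move: (dot e d) (dot d d) ed0 dd0 quad => a b a0 b0 quad.
(* For [s = a / (a + b)], [s ^+ 2 * b] is less than [s * a], against [quad]. The summand [a] in the
   denominator covers [b = 0]. *)
have ab0 : 0 < a + b by lra.
have sE : a / (a + b) * (a + b) = a by rewrite divfK ?gt_eqF.
have s0 : 0 < a / (a + b) by rewrite divr_gt0.
have s1 : a / (a + b) <= 1 by rewrite ler_pdivrMr// mul1r; lra.
have := quad _ (ltW s0) s1; move: (a / (a + b)) s0 sE => s s0 sE q.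
have sa0 : 0 < s * a by exact: mulr_gt0.
have : s ^+ 2 * b = s * a - s * (s * a) by rewrite -{1}sE; ring.
have : 0 < s * (s * a) by exact: mulr_gt0.
lra.
Qed.

(** Sum of two obtuse-angle inequalities, each projection being the test point for the other. *)
Lemma eproj_firmly_nonexpansive C u v :
  has_nearest C -> segment_closed C ->
  dot (eproj C v - eproj C u) (eproj C v - eproj C u) <=
    dot (v - u) (eproj C v - eproj C u).
Proof.
move=> nC cC.
have := eproj_obtuse u nC cC (eproj_in v nC).
have := eproj_obtuse v nC cC (eproj_in u nC).
set p := eproj C u; set q := eproj C v.
by rewrite !dotE (dotC p q); lra.
Qed.

End Projection.

(** * The cone over [Z] and the decisions read off from it *)

Section Lifting.
Variables (R : realType) (k : nat) (Z : set 'rV[R]_k).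
Implicit Types (z h : 'rV[R]_k) (w : 'rV[R]_(1 + k)).

Lemma dot_pairv (a b : R) z z' :
  dot (pairv a z) (pairv b z') = a * b + dot z z'.
Proof.
rewrite /dot big_split_ord/= big_ord1 !row_mxEl !mxE eqxx !mulr1n.
by congr (_ + _); apply: eq_bigr => i _; rewrite !row_mxEr.
Qed.

Lemma scale_pairv (c a : R) z : c *: pairv a z = pairv (c * a) (c *: z).
Proof. by rewrite /pairv scale_row_mx scale_scalar_mx. Qed.

Lemma add_pairv (a b : R) z z' :
  pairv a z + pairv b z' = pairv (a + b) (z + z').
Proof. by rewrite /pairv add_row_mx raddfD. Qed.

Lemma fstc_pairv (a : R) z : fstc (pairv a z) = a.
Proof. by rewrite /fstc row_mxKl mxE eqxx mulr1n. Qed.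

Lemma sndc_pairv (a : R) z : sndc (pairv a z) = z.
Proof. exact: row_mxKr. Qed.

(** The Euclidean norm of [z] dominates each of its coordinates, so the first entry [a] is the
    largest. *)
Lemma maxnorm_pairv (a : R) z : norm2 z <= a -> `|pairv a z| = a.
Proof.
move=> za; have a0 : 0 <= a by exact: le_trans (norm2_ge0 _) za.
apply/le_anti/andP; split; rewrite {1}/Num.norm/= mx_normrE.
  apply: bigmax_le => // -[i j] _ /=; rewrite ord1.
  case: (split_ordP j) => l ->; last first.
    by rewrite row_mxEr (le_trans (coord_le_norm2 _ _)).
  by rewrite row_mxEl ord1 mxE eqxx mulr1n ger0_norm.
apply: le_trans (le_bigmax _ _ (0, lshift k 0)) => /=.
by rewrite row_mxEl mxE eqxx mulr1n ger0_norm.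
Qed.

Lemma coneofP w : coneof Z w <->
  exists (a : R) z, [/\ 0 <= a, Z z & w = a *: pairv (max_norm2 Z) z].
Proof.
split=> [[a [_ [a0 [z Zz <-] ->]]]|[a [z [a0 Zz ->]]]]; first by exists a, z.
by exists a, (pairv (max_norm2 Z) z); split=> //; exists z.
Qed.

Lemma coneof0 : Z !=set0 -> coneof Z 0.
Proof.
by case=> z Zz; apply/coneofP; exists 0, z; rewrite scale0r.
Qed.

Hypothesis Z_convex : convex_set Z.

(** The coefficients combine to [c], and the points of [Z] are averaged with weights
    [(1 - s) * a / c] and [s * b / c]. If [c = 0], both terms vanish. *)
Lemma coneof_convex : segment_closed (coneof Z).
Proof.
move=> _ _ s /coneofP[a [z [a0 Zz ->]]] /coneofP[b [z' [b0 Zz' ->]]] s0 s1.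
set c := (1 - s) * a + s * b.
have sa0 : 0 <= (1 - s) * a by rewrite mulr_ge0 // subr_ge0.
have sb0 : 0 <= s * b by rewrite mulr_ge0.
rewrite scalerBr addrCA -[X in _ + (X - _)]scale1r -scalerBl addrC !scalerA.
have [c0|c0] := leP c 0.
  have -> : (1 - s) * a = 0 by move: sa0 sb0 c0; rewrite /c; lra.
  have -> : s * b = 0 by move: sa0 sb0 c0; rewrite /c; lra.
  by rewrite !scale0r addr0; apply: coneof0; exists z.
have t0 : 0 <= (1 - s) * a / c by rewrite divr_ge0 // ltW.
have t1 : (1 - s) * a / c <= 1 by rewrite ler_pdivrMr // mul1r lerDl.
have tE : 1 - (1 - s) * a / c = s * b / c.
  by rewrite /c; field; exact: lt0r_neq0.
have Zzz' : Z (((1 - s) * a / c) *: z + (s * b / c) *: z').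
  rewrite -tE; apply/set_mem.
  by have := Z_convex (Itv01 t0 t1) (mem_set Zz) (mem_set Zz').
apply/coneofP; exists c, (((1 - s) * a / c) *: z + (s * b / c) *: z').
split=> //; first exact: ltW.
rewrite !scale_pairv add_pairv -mulrDl scalerDr !scalerA.
by rewrite !(mulrC c) !divfK ?gt_eqF.
Qed.

Hypothesis Z_nonempty : Z !=set0.
Hypothesis Z_compact : compact Z.
Hypothesis Z_neq0 : Z <> [set 0].

(** [sup] dominates the norms once they are bounded; the bound is the maximum of a continuous
    function on the compact [Z]. *)
Lemma norm2_le_max_norm2 z : Z z -> norm2 z <= max_norm2 Z.
Proof.
move=> Zz.
have dot_cont : {within Z, continuous (fun z => dot z z)}.
  by apply/continuous_subspaceT/continuous_dot; exact: coord_continuous.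
have [c Zc cmax] := compact_EVT_max Z_nonempty Z_compact dot_cont.
apply: ub_le_sup; last by exists z.
exists (norm2 c) => _ [z' Zz' <-].
by rewrite ler_norm2 cmax //; exact/mem_set.
Qed.

Lemma max_norm2_gt0 : 0 < max_norm2 Z.
Proof.
rewrite ltNge; apply/negP => k0; apply: Z_neq0.
have Z0 z : Z z -> z = 0.
  move=> /norm2_le_max_norm2 zk; apply: dot_le0.
  suff -> : dot z z = 0 by [].
  rewrite -norm2_sqr (le_anti (_ : norm2 z <= 0 <= norm2 z)) ?expr0n //.
  by rewrite (le_trans zk) ?norm2_ge0.
apply/seteqP; split=> [z /Z0 //|_ ->].
by case: Z_nonempty => z Zz; rewrite -(Z0 z).
Qed.

Lemma coneof_has_nearest : has_nearest (coneof Z).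
Proof.
(* Points of the cone with coefficient at least M are no nearer to u than 0, so
   it suffices to minimise over the compact set [0, M] x Z. *)
move=> u; set kappa := max_norm2 Z; have k0 : 0 < kappa := max_norm2_gt0.
set f := fun p : R * 'rV[R]_k =>
  dot (u - p.1 *: pairv kappa p.2) (u - p.1 *: pairv kappa p.2).
(* A cone point with coefficient [b] has first entry [b * kappa], so [b > M] forces its norm to be
   at least [2 * norm2 u]. *)
set M := 2 * norm2 u / kappa.
have M0 : 0 <= M by rewrite divr_ge0 ?mulr_ge0 ?norm2_ge0 // ltW.
have f_cont : continuous f.
  suff coord_cont i : continuous
      (fun p : R * 'rV[R]_k => (u - p.1 *: pairv kappa p.2) 0 i).
    by apply: continuous_dot; exact: coord_cont.
  have -> : (fun p : R * 'rV[R]_k => (u - p.1 *: pairv kappa p.2) 0 i) =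
      (fun p => u 0 i - p.1 * pairv kappa p.2 0 i).
    by apply/funext => p; rewrite !mxE.
  move=> p; apply: cvgB; first exact: cvg_cst.
  apply: cvgM; first exact: cvg_fst.
  case: (split_ordP i) => j ->.
    rewrite row_mxEl [X in X @ _ --> _](_ : _ = fun=> (kappa%:M : 'rV_1) 0 j).
      exact: cvg_cst.
    by apply/funext => q; rewrite row_mxEl.
  rewrite row_mxEr [X in X @ _ --> _](_ : _ = fun q : R * 'rV[R]_k => q.2 0 j).
    apply: (@continuous_comp _ _ _ snd (fun z : 'rV[R]_k => z 0 j)).
      exact: cvg_snd.
    exact: coord_continuous.
  by apply/funext => q; rewrite row_mxEr.
have [z0 Zz0] := Z_nonempty.
have [||[a z] /set_mem[/= aM Zz] fmin] :=
    @compact_EVT_min _ _ f (`[0, M] `*` Z) _ _ (continuous_subspaceT f_cont).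
- by exists (0, z0); split=> //=; rewrite in_itv /= lexx.
- by apply: compact_setX => //; exact: segment_compact.
exists (a *: pairv kappa z); split.
  by apply/coneofP; exists a, z; split=> //; case/andP: aM.
move=> _ /coneofP[b [z' [b0 Zz' ->]]]; rewrite ler_norm2.
have [bM|Mb] := leP b M.
  by apply: (fmin (b, z')); apply/mem_set; split=> //=; rewrite in_itv /= b0.
apply: (@le_trans _ _ (dot u u)).
  rewrite -[u in leRHS](subr0 u) -(scale0r (pairv kappa z0)).
  by apply: (fmin (0, z0)); apply/mem_set; split=> //=; rewrite in_itv /= lexx.
rewrite -/kappa; set w := b *: pairv kappa z'.
have : 4 * dot u u <= dot w w.
  rewrite /w dotZl dotZr dot_pairv -norm2_sqr.
  have : 2 * norm2 u <= b * kappa by rewrite -ler_pdivrMr // ltW.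
  have := dot_ge0 z'; have := norm2_ge0 u; have := mulr_ge0 b0 (ltW k0).
  move: (norm2 u) (dot z' z') => N D x0 N0 D0 x1.
  have : (2 * N) ^+ 2 <= (b * kappa) ^+ 2.
    by rewrite lerXn2r ?nnegrE // mulr_ge0.
  have : 0 <= b ^+ 2 * D by rewrite mulr_ge0 ?sqr_ge0.
  lra.
(* This gives [dot u w <= dot u u + dot w w / 4], so the squared distance from [u] to [w] is at
   least [dot w w / 2 - dot u u]. *)
have := dot_ge0 (2 *: u - w).
by move: w => w; rewrite !dotE (dotC w u); lra.
Qed.

Lemma maxnorm_coneof w : coneof Z w -> `|w| = fstc w.
Proof.
case/coneofP=> a [z [a0 Zz ->]].
rewrite normrZ maxnorm_pairv ?norm2_le_max_norm2 //.
by rewrite scale_pairv fstc_pairv ger0_norm.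
Qed.

Lemma coneof_fstc0 w : coneof Z w -> fstc w = 0 -> w = 0.
Proof. by move=> /maxnorm_coneof <- /eqP; rewrite normr_eq0 => /eqP. Qed.

Lemma decision_of_in z0 w : Z z0 -> coneof Z w -> Z (decision_of Z z0 w).
Proof.
move=> Zz0 /coneofP[a [z [a0 Zz ->]]]; rewrite /decision_of scale_pairv.
rewrite fstc_pairv sndc_pairv; case: ifPn => //.
rewrite mulf_eq0 negb_or => /andP[an0 kn0].
by rewrite scalerA invfM mulrCA mulrV ?unitfE // mulr1 mulVf // scale1r.
Qed.

(** On the cone, [sndc w] is [fstc w / max_norm2 Z] times the decision, even when [fstc w = 0]: then
    [w = 0], whatever the default point. *)
Lemma dot_payoff z0 z h w : coneof Z w ->
  dot (payoff Z z h) w =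
    fstc w / max_norm2 Z * (dot h z - dot h (decision_of Z z0 w)).
Proof.
have k0 := max_norm2_gt0.
move=> Cw; have [w0|w0] := eqVneq (fstc w) 0.
  by rewrite w0 (coneof_fstc0 Cw w0) dot0r !mul0r.
rewrite /decision_of w0 /payoff.
case/coneofP: Cw w0 => a [y [a0 Zy ->]]; rewrite scale_pairv.
rewrite fstc_pairv sndc_pairv dot_pairv !dotE mulf_eq0 negb_or.
move=> /andP[an0 kn0].
by field; rewrite kn0.
Qed.

(** Common final stage for CBA and CBA+, which differ only in how they supply the inner-product
    hypothesis. *)
Lemma decision_of_descent z0 h (omega : R) w w' :
  0 < omega -> coneof Z w -> coneof Z w' ->
  dot (w - w') (w - w') <=
    dot (omega *: payoff Z (decision_of Z z0 w') h) (w - w') ->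
  dot h (decision_of Z z0 w) - dot h (decision_of Z z0 w') <=
    - (max_norm2 Z / (omega * `|w|) * norm2 (w - w') ^+ 2).
Proof.
move=> om0 Cw Cw'; rewrite norm2_sqr dotZl.
(* The payoff is built from the decision of [w'], hence orthogonal to [w']. *)
have -> : dot (payoff Z (decision_of Z z0 w') h) (w - w') =
    fstc w / max_norm2 Z *
      (dot h (decision_of Z z0 w') - dot h (decision_of Z z0 w)).
  by rewrite dotDr dotNr !(dot_payoff z0) // subrr mulr0 subr0.
rewrite maxnorm_coneof //; have [w0|w0] := eqVneq (fstc w) 0.
  rewrite w0 !(mul0r, mulr0) invr0 (coneof_fstc0 Cw w0) mulr0 mul0r oppr0.
  move=> /dot_le0/eqP; rewrite sub0r oppr_eq0 => /eqP ->.
  by rewrite subrr.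
have k0 := max_norm2_gt0.
have fw0 : 0 < fstc w.
  by rewrite lt_def w0 -maxnorm_coneof ?normr_ge0.
rewrite -[X in _ -> X <= _]opprB lerN2 => le_dot.
rewrite mulrC -ler_pdivlMr ?divr_gt0 ?mulr_gt0 //; apply: le_trans le_dot _.
by rewrite le_eqVlt; apply/orP; left; apply/eqP; field; rewrite !gt_eqF.
Qed.

End Lifting.

(* `|u| is the max norm of the vector u. Division by 0 yields 0 in the library,
   which gives the convention 0 / 0 = 0 in both bounds. *)
Theorem theorem3p6 (R : realType) (n m : nat)
    (X : set 'rV[R]_n) (Y : set 'rV[R]_m)
    (X_nonempty : X !=set0) (X_convex : convex_set X) (X_compact : compact X)
    (X_neq0 : X <> [set 0])
    (Y_nonempty : Y !=set0) (Y_convex : convex_set Y) (Y_compact : compact Y)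
    (Y_neq0 : Y <> [set 0])
    (F : 'rV[R]_n -> 'rV[R]_m -> R) (h : 'rV[R]_m -> 'rV[R]_n)
    (F_subdiff : subdifferentiable X Y F)
    (F_convex_concave : convex_concave X Y F)
    (F_linear : linear_in_fst X Y F h)
    (x0 : 'rV[R]_n) (y0 : 'rV[R]_m) (x0X : X x0) (y0Y : Y y0)
    (omega : nat -> R) (omega_gt0 : forall t, (1 <= t)%N -> 0 < omega t) :
  (forall (ux : nat -> 'rV[R]_(1 + n)) (uy : nat -> 'rV[R]_(1 + m))
      (x : nat -> 'rV[R]_n) (y g : nat -> 'rV[R]_m),
    alternating_play Y F h (CBAplus X x0) (CBAplus Y y0) y0 omega ux uy x y g ->
    forall t : nat, (1 <= t)%N ->
      F (x t.+1) (y t) - F (x t) (y t) <=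
        - (max_norm2 X / (omega t * `|ux t|) * norm2 (ux t - ux t.-1) ^+ 2)) /\
  (forall (ux : nat -> 'rV[R]_(1 + n)) (uy : nat -> 'rV[R]_(1 + m))
      (x : nat -> 'rV[R]_n) (y g : nat -> 'rV[R]_m),
    alternating_play Y F h (CBA X x0) (CBA Y y0) y0 omega ux uy x y g ->
    forall t : nat, (1 <= t)%N ->
      F (x t.+1) (y t) - F (x t) (y t) <=
        - (max_norm2 X / (omega t * `|eproj (coneof X) (ux t)|) *
           norm2 (eproj (coneof X) (ux t) - eproj (coneof X) (ux t.-1)) ^+ 2)).
Proof.
have nX := coneof_has_nearest X_nonempty X_compact X_neq0.
have nY := coneof_has_nearest Y_nonempty Y_compact Y_neq0.
have cX := coneof_convex X_convex.
have descent := decision_of_descent X_nonempty X_compact X_neq0.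
(* The round [t >= 1] becomes [t.+1]: [step t] describes it and [step t.+1] gives the next
   decision. *)
split=> ux uy x y g [ux0 _ _ step] [//|t] _ /=; have om0 := omega_gt0 t.+1 isT.
- have [/= xt _ uyt yt uxt] := step t; have [/= xt1 _ _ _ _] := step t.+1.
  (* CBA+ aggregates start at 0 and are projected at each update. *)
  have Cux s : coneof X (ux s).
    case: s => [|s]; first by rewrite ux0; exact: coneof0.
    by have [_ _ _ _ /= ->] := step s; exact: eproj_in.
  have Yt : Y (y t.+1).
    by rewrite yt; apply: decision_of_in => //; rewrite uyt; exact: eproj_in.
  have Xt : X (x t.+1) by rewrite xt; exact: decision_of_in.
  have Xt1 : X (x t.+2) by rewrite xt1; exact: decision_of_in.
  rewrite !F_linear // xt1 [in - dot _ _]xt.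
  apply: descent => //; rewrite -xt.
  set v := _ *: payoff _ _ _ in uxt *.
  (* Testing against the previous aggregate gives [dot (w' + v - w) (w' - w) <= 0], a rearrangement
     of the goal. *)
  have := eproj_obtuse (ux t + v) nX cX (Cux t).
  rewrite -uxt; move: (ux t.+1) (ux t) v {uxt} => w w' v.
  by rewrite !dotE (dotC w w'); lra.
- have [/= xt _ uyt yt uxt] := step t; have [/= xt1 _ _ _ _] := step t.+1.
  have Cux s : coneof X (eproj (coneof X) (ux s)) by exact: eproj_in.
  have Yt : Y (y t.+1).
    by rewrite yt; apply: decision_of_in => //; exact: eproj_in.
  have Xt : X (x t.+1) by rewrite xt; exact: decision_of_in.
  have Xt1 : X (x t.+2) by rewrite xt1; exact: decision_of_in.
  rewrite !F_linear // xt1 [in - dot _ _]xt.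
  apply: descent => //; rewrite -xt.
  (* Unprojected aggregates differ exactly by the weighted payoff. *)
  have := eproj_firmly_nonexpansive (ux t) (ux t.+1) nX cX.
  suff <- : ux t.+1 - ux t = omega t.+1 *: payoff X (x t.+1) (h (y t.+1)) by [].
  by rewrite uxt addrC addKr.
Qed.
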